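(* Assume $\sum_x\pi^0(x)\mathcal Y(x)=0$. Suppose that the input $\phi_k(u\mid s)=\phi^\star(u\mid s;r_k)$ is applied to the nonlinear system $\nu_{k+1}(s',u')=\sum_{x\in\mathsf X}\nu_k(x)T(x,s')\phi_k(u'\mid s')$, where $\phi^\star(\cdot\mid\cdot\,;r)$ is the IPD-Q solution with reference value $r$. The closed loop dynamics then admit the approximation $$\tilde X_{k+1}=A\tilde X_k+BG^\star r_k+\varepsilon_k+O(r_k^2),$$ in which $A_{i,j}=P^0(x^j,x^i)$ and $B_{i,j}=\mathbb I\{i=j\}\hat\nu^0(s^j)$ for $1\le i,j\le n$, $G^\star$ is the column vector with entries $G_i^\star=\phi^0(u^i\mid s^i)\Lambda_{\mathsf n}(x^i)$, and $\varepsilon_k$ is quadratic in the deviation $(\tilde\nu_k,\tilde\phi_k)$: $$\varepsilon_k^i=\sum_j\tilde\nu_k(x^j)\,T(x^j,s^i)\,\tilde\phi_k(u^i\mid s^i),\qquad x^i=(s^i,u^i)\in\mathsf X.$$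
   Context: $\mathsf S$ and $\mathsf U$ are finite sets, $\mathsf X=\mathsf S\times\mathsf U=\{x^i=(s^i,u^i):1\le i\le n\}$, $n=|\mathsf X|$. $T$ is a controlled transition matrix ($T(x,\cdot)$ a pmf on $\mathsf S$), $\phi^0$ a nominal randomized policy ($\phi^0(\cdot\mid s)$ a pmf on $\mathsf U$), $P_\phi(x,x')=T(x,s')\phi(u'\mid s')$ for $x'=(s',u')$, and $P^0=P_{\phi^0}$ is assumed to have a unique invariant pmf $\pi^0$; $\hat\nu^0(s)=\sum_u\pi^0(s,u)$. $\mathcal Y:\mathsf X\to\mathbb R$, $\kappa>0$. Deviations: $\tilde\nu_k=\nu_k-\pi^0$, $\tilde\phi_k=\phi_k-\phi^0$, and $\tilde X_k\in\mathbb R^n$ has entries $\tilde X_k^i=\tilde\nu_k(x^i)$. IPD-Q problem: minimize $\sum_{s,u}\pi(s,u)\log\frac{\phi(u\mid s)}{\phi^0(u\mid s)}+\frac\kappa2[\langle\pi,\mathcal Y\rangle-r]^2$ over $(\pi,\phi)$ with $\pi P_\phi=\pi$. It is solved by a Lagrangian relaxation as follows. For $\lambda\in\mathbb R$ let $(\xi^\lambda,h^\lambda)$, $\xi^\lambda\in\mathbb R$, $h^\lambda:\mathsf S\to\mathbb R$, solve $$\xi^\lambda+h^\lambda(s)=\max_{\mu}\Big\{\sum_u\mu(u)\Big[\lambda\mathcal Y(s,u)-\log\frac{\mu(u)}{\phi^0(u\mid s)}\Big]+\sum_u\mu(u)\sum_{s'}T((s,u),s')h^\lambda(s')\Big\},$$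 the maximum being over pmfs $\mu$ on $\mathsf U$, with $h^\lambda$ chosen continuously differentiable in $\lambda$ and $h^0\equiv0$. Put $\bar h^\lambda(x)=\sum_{s'}T(x,s')h^\lambda(s')$. The optimal policy is $$\phi^\lambda(u\mid s)=\phi^0(u\mid s)\exp\big(\bar h^\lambda(s,u)+\lambda\mathcal Y(s,u)-\Gamma^\lambda(s)\big),\quad\Gamma^\lambda(s)=\log\sum_u\phi^0(u\mid s)\exp\big(\bar h^\lambda(s,u)+\lambda\mathcal Y(s,u)\big),$$ and $\pi^\lambda$ is the invariant pmf of $P_{\phi^\lambda}$. With $r^\lambda=\langle\pi^\lambda,\mathcal Y\rangle+\lambda/\kappa$, the IPD-Q solution is $\phi^\star(\cdot\mid\cdot\,;r)=\phi^\lambda$ for $\lambda=\lambda_r$ with $r^{\lambda_r}=r$. Notation: $\varsigma_\lambda^2=\frac{d^2}{d\lambda^2}\xi^\lambda$; $\bar H^\lambda=\frac{d}{d\lambda}\bar h^\lambda$; $\bar H_s^0=\sum_u\phi^0(u\mid s)\bar H^0(s,u)$; $\mathcal Y_s=\sum_u\phi^0(u\mid s)\mathcal Y(s,u)$; $$\Lambda(x)=\bar H^0(x)+\mathcal Y(x)-(\bar H_s^0+\mathcal Y_s),\qquad\Lambda_{\mathsf n}(x)=\Big(\varsigma_0^2+\frac1\kappa\Big)^{-1}\Lambda(x),\qquad x=(s,u).$$ *)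

(* Defs.v *)
From mathcomp Require Import all_boot all_order all_algebra.
From mathcomp Require Import all_classical all_reals all_analysis.
From mathcomp Require Import ring lra.

Set Implicit Arguments.
Unset Strict Implicit.
Unset Printing Implicit Defensive.

Import Order.TTheory GRing.Theory Num.Theory.
Import numFieldNormedType.Exports.

Local Open Scope classical_set_scope.
Local Open Scope ring_scope.

Definition is_pmf (R : realType) (E : finType) (p : E -> R) : Prop :=
  (forall x, 0 <= p x) /\ \sum_x p x = 1.

Definition mean (R : realType) (E : finType) (p f : E -> R) : R :=
  \sum_x p x * f x.

Definition invariant_pmf (R : realType) (E : finType) (P : E -> E -> R)
    (p : E -> R) : Prop :=
  is_pmf p /\ forall x', \sum_x p x * P x x' = p x'.

Definition is_max (d : Order.disp_t) (V : porderType d) (A : set V) (v : V)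
    : Prop :=
  A v /\ ubound A v.

(* The extended-real operations give [log (p / 0) = +oo] for [0 < p] and
   [log (0 / q) = -oo]; since [0 * -oo = 0], weighted sums of log-ratios follow
   the usual conventions for relative entropy, also where [phi0] vanishes. *)
Definition log_ratio (R : realType) (p q : R) : \bar R :=
  lne (p%:E / q%:E)%E.

(* The transition matrix P_phi on S * U. *)
Definition trans (R : realType) (S U : finType) (T : S * U -> S -> R)
    (phi : S -> U -> R) (x x' : S * U) : R :=
  T x x'.1 * phi x'.1 x'.2.

Definition hbar (R : realType) (S U : finType) (T : S * U -> S -> R)
    (h : S -> R) (x : S * U) : R :=
  \sum_s' T x s' * h s'.

Definition one_step_value (R : realType) (S U : finType)
    (T : S * U -> S -> R) (phi0 : S -> U -> R) (Y : S * U -> R)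
    (lam : R) (h : S -> R) (s : S) (mu : U -> R) : \bar R :=
  (\sum_u (mu u)%:E * ((lam * Y (s, u))%:E - log_ratio (mu u) (phi0 s u))
   + \sum_u (mu u)%:E * (\sum_s' T (s, u) s' * h s')%:E)%E.

Definition optimality_equation (R : realType) (S U : finType)
    (T : S * U -> S -> R) (phi0 : S -> U -> R) (Y : S * U -> R)
    (lam xi : R) (h : S -> R) : Prop :=
  forall s, is_max (one_step_value T phi0 Y lam h s @` [set mu | is_pmf mu])
                   (xi + h s)%:E.

Definition Gamma (R : realType) (S U : finType)
    (T : S * U -> S -> R) (phi0 : S -> U -> R) (Y : S * U -> R)
    (lam : R) (h : S -> R) (s : S) : R :=
  ln (\sum_u phi0 s u * expR (hbar T h (s, u) + lam * Y (s, u))).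

(* The policy phi^lam, for [h] = h^lam. *)
Definition opt_policy (R : realType) (S U : finType)
    (T : S * U -> S -> R) (phi0 : S -> U -> R) (Y : S * U -> R)
    (lam : R) (h : S -> R) (s : S) (u : U) : R :=
  phi0 s u *
    expR (hbar T h (s, u) + lam * Y (s, u) - Gamma T phi0 Y lam h s).

(* The reference value r^lam attained at the multiplier lam, for [p] = pi^lam. *)
Definition ref_value (R : realType) (E : finType) (kappa : R) (Y : E -> R)
    (lam : R) (p : E -> R) : R :=
  mean p Y + lam / kappa.

Definition ipdq_cost (R : realType) (S U : finType) (phi0 : S -> U -> R)
    (Y : S * U -> R) (kappa r : R) (p : S * U -> R) (phi : S -> U -> R)
    : \bar R :=
  (\sum_s \sum_u (p (s, u))%:E * log_ratio (phi s u) (phi0 s u)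
   + (kappa / 2 * (mean p Y - r) ^+ 2)%:E)%E.

Definition ipdq_feasible (R : realType) (S U : finType)
    (T : S * U -> S -> R) (p : S * U -> R) (phi : S -> U -> R) : Prop :=
  (forall s, is_pmf (phi s)) /\ invariant_pmf (trans T phi) p.

(* \bar H^0, the derivative of hbar^lam at lam = 0, for [h lam] = h^lam. *)
Definition Hbar0 (R : realType) (S U : finType) (T : S * U -> S -> R)
    (h : R -> S -> R) (x : S * U) : R :=
  derive1 (fun lam : R => hbar T (h lam) x) 0.

Definition policy_mean (R : realType) (S U : finType) (phi0 : S -> U -> R)
    (f : S * U -> R) (s : S) : R :=
  \sum_u phi0 s u * f (s, u).

Definition Lambda (R : realType) (S U : finType) (T : S * U -> S -> R)
    (phi0 : S -> U -> R) (Y : S * U -> R) (h : R -> S -> R) (x : S * U) : R :=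
  Hbar0 T h x + Y x
  - (policy_mean phi0 (Hbar0 T h) x.1 + policy_mean phi0 Y x.1).

Definition Lambda_n (R : realType) (S U : finType) (T : S * U -> S -> R)
    (phi0 : S -> U -> R) (Y : S * U -> R) (kappa : R)
    (xi : R -> R) (h : R -> S -> R) (x : S * U) : R :=
  (derive1n 2 xi 0 + kappa^-1)^-1 * Lambda T phi0 Y h x.

Lemma log_ratioE (R : realType) (p q : R) : 0 < p -> 0 < q ->
  log_ratio p q = (ln (p / q))%:E.
Proof.
move=> p0 q0; rewrite /log_ratio inver gt_eqF// -EFinM lne_EFin//.
by rewrite divr_gt0.
Qed.

Lemma log_ratio_pinfty (R : realType) (p : R) : 0 < p ->
  log_ratio p 0 = +oo%E.
Proof. by move=> p0; rewrite /log_ratio inver eqxx gt0_muley. Qed.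

Lemma mul_log_ratioE (R : realType) (w p q : R) : 0 <= w ->
  (0 < w -> 0 < p /\ 0 < q) ->
  (w%:E * log_ratio p q)%E = (w * ln (p / q))%:E.
Proof.
rewrite le_eqVlt => /predU1P[<- _|w0 /(_ w0)[p0 q0]].
  by rewrite mul0e mul0r.
by rewrite log_ratioE.
Qed.

Lemma pmf_gt0 (R : realType) (E : finType) (p : E -> R) :
  is_pmf p -> exists x, 0 < p x.
Proof.
move=> [p0 p1]; apply: contrapT => /forallNP p_le0.
have := oner_neq0 R; rewrite -p1 big1 ?eqxx// => x _.
by apply: le_anti; rewrite p0 andbT leNgt; apply/negP.
Qed.

Section opt_policy.
Variables (R : realType) (S U : finType) (T : S * U -> S -> R).
Variables (phi0 : S -> U -> R) (Y : S * U -> R).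
Hypothesis phi0_pmf : forall s, is_pmf (phi0 s).
Variables (lam : R) (h : S -> R).
Let g s u := hbar T h (s, u) + lam * Y (s, u).
Let G := Gamma T phi0 Y lam h.
Let phi1 := opt_policy T phi0 Y lam h.

Lemma opt_policy_sum_gt0 s : 0 < \sum_u phi0 s u * expR (g s u).
Proof.
have [p0 p1] := phi0_pmf s; have [u pu] := pmf_gt0 (phi0_pmf s).
rewrite (bigD1 u)//= ltr_pwDl ?mulr_gt0 ?expR_gt0//.
by rewrite sumr_ge0// => v _; rewrite mulr_ge0 ?expR_ge0.
Qed.

Lemma opt_policy_pmf s : is_pmf (phi1 s).
Proof.
have [p0 p1] := phi0_pmf s; split=> [u|].
  by rewrite mulr_ge0 ?expR_ge0.
under eq_bigr do rewrite /phi1 /opt_policy expRD expRN mulrA.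
by rewrite -mulr_suml /Gamma lnK ?posrE ?opt_policy_sum_gt0// divff// gt_eqF
  ?opt_policy_sum_gt0.
Qed.

Lemma one_step_valueE s (mu : U -> R) : is_pmf mu ->
  (forall u, 0 < mu u -> 0 < phi0 s u) ->
  one_step_value T phi0 Y lam h s mu =
  (\sum_u mu u * (g s u - ln (mu u / phi0 s u)))%:E.
Proof.
move=> [m0 m1] ac; rewrite /one_step_value -big_split/= -sumEFin.
apply: eq_bigr => u _; have := m0 u; rewrite le_eqVlt => /predU1P[<-|m_gt0].
  by rewrite !mul0e !mul0r add0e.
rewrite log_ratioE ?ac// -EFinB -!EFinM -EFinD; congr _%:E.
by rewrite /g /hbar; ring.
Qed.

Lemma one_step_value_opt s :
  one_step_value T phi0 Y lam h s (phi1 s) = (G s)%:E.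
Proof.
have [m0 m1] := opt_policy_pmf s; have [p0 _] := phi0_pmf s.
have ac u : 0 < phi1 s u -> 0 < phi0 s u.
  by move=> pu; rewrite -(pmulr_lgt0 _ (expR_gt0 (g s u - G s))).
rewrite one_step_valueE//.
rewrite -[G s]mul1r -m1 mulr_suml; congr _%:E; apply: eq_bigr => u _.
have := p0 u; rewrite le_eqVlt => /predU1P[pu|pu].
  by rewrite /phi1 /opt_policy -pu !mul0r.
congr (_ * _); rewrite /phi1 /opt_policy mulrAC divff ?gt_eqF// mul1r expRK.
by rewrite /g /G; ring.
Qed.

Lemma one_step_value_le s (mu : U -> R) : is_pmf mu ->
  (one_step_value T phi0 Y lam h s mu <= (G s)%:E)%E.
Proof.
move=> mu_pmf; have [m0 m1] := mu_pmf; have [p0 _] := phi0_pmf s.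
have [ac|/existsNP[u /not_implyP[mu_u /negP]]] :=
    pselect (forall u, 0 < mu u -> 0 < phi0 s u).
  rewrite one_step_valueE// lee_fin -[leRHS]mul1r -m1 mulr_suml.
  rewrite -subr_ge0 -sumrB.
  have sum0 : \sum_u (mu u - phi1 s u) = 0.
    by rewrite sumrB m1 (opt_policy_pmf s).2 subrr.
  rewrite -[leLHS]sum0.
  apply: ler_sum => u _; have := m0 u; rewrite le_eqVlt => /predU1P[<-|mu_u].
    by rewrite !mul0r subrr sub0r oppr_le0; case: (opt_policy_pmf s).
  have q_gt0 := ac _ mu_u.
  rewrite -mulrBr -ler_pdivrMl// mulrBr mulVf ?gt_eqF//.
  have -> : (mu u)^-1 * phi1 s u =
      expR (g s u - G s - ln (mu u / phi0 s u)).
    rewrite expRD expRN lnK ?posrE ?divr_gt0// invfM invrK.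
    by rewrite /phi1 /opt_policy; ring.
  have := expR_ge1Dx (g s u - G s - ln (mu u / phi0 s u)).
  lra.
rewrite -leNgt => q_le0.
have q0 : phi0 s u = 0 by apply: le_anti; rewrite q_le0 p0.
rewrite /one_step_value [X in (X + _)%E](_ : _ = -oo%E) ?addNye ?leNye//.
apply/esum_eqNyP; exists u; split => //.
by rewrite q0 log_ratio_pinfty//= gt0_muleNy.
Qed.

Lemma optimality_equationE xi s :
  optimality_equation T phi0 Y lam xi h -> xi + h s = G s.
Proof.
move=> /(_ s)[[mu mu_pmf muE] ub]; apply: EFin_inj; apply/le_anti/andP; split.
  by rewrite -muE; exact: one_step_value_le.
by apply: ub; exists (phi1 s); [exact: opt_policy_pmf|exact: one_step_value_opt].
Qed.

End opt_policy.

Section ipdq.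
Variables (R : realType) (S U : finType) (T : S * U -> S -> R).
Variables (phi0 : S -> U -> R) (Y : S * U -> R).
Hypothesis T_pmf : forall z, is_pmf (T z).
Hypothesis phi0_pmf : forall s, is_pmf (phi0 s).
Variables (lam xi : R) (h : S -> R).
Hypothesis opt_eq : optimality_equation T phi0 Y lam xi h.
Let phi1 := opt_policy T phi0 Y lam h.

Lemma invariant_marginal (p : S * U -> R) (phi : S -> U -> R) s :
  ipdq_feasible T p phi -> \sum_u p (s, u) = \sum_z p z * T z s.
Proof.
move=> [phi_pmf [_ inv]]; under eq_bigr do rewrite -inv /trans/=.
rewrite exchange_big/=; apply: eq_bigr => z _.
under eq_bigr do rewrite mulrA.
by rewrite -mulr_sumr (phi_pmf s).2 mulr1.
Qed.

Lemma invariant_factor (p : S * U -> R) (phi : S -> U -> R) s u :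
  ipdq_feasible T p phi -> p (s, u) = (\sum_v p (s, v)) * phi s u.
Proof.
move=> feas; rewrite (invariant_marginal s feas) mulr_suml.
have [_ [_ inv]] := feas.
by rewrite -[LHS]inv; apply: eq_bigr => z _; rewrite /trans mulrA.
Qed.

Lemma invariant_mean_h (p : S * U -> R) (phi : S -> U -> R) :
  ipdq_feasible T p phi ->
  \sum_z p z * hbar T h z = \sum_z p z * h z.1.
Proof.
move=> feas.
have -> : \sum_z p z * h z.1 = \sum_s \sum_u p (s, u) * h s.
  by rewrite pair_bigA; apply: eq_bigr => -[].
under [RHS]eq_bigr do rewrite -mulr_suml (invariant_marginal _ feas) mulr_suml.
rewrite exchange_big/=; apply: eq_bigr => z _.
by rewrite mulr_sumr; apply: eq_bigr => s _; rewrite mulrA.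
Qed.

Lemma ipdq_costE (kappa r : R) (p : S * U -> R) (phi : S -> U -> R) :
  ipdq_feasible T p phi -> (forall s u, 0 < p (s, u) -> 0 < phi0 s u) ->
  ipdq_cost phi0 Y kappa r p phi =
  (\sum_z p z * ln (phi z.1 z.2 / phi0 z.1 z.2)
   + kappa / 2 * (mean p Y - r) ^+ 2)%:E.
Proof.
move=> feas ac; rewrite /ipdq_cost pair_bigA/= EFinD -sumEFin; congr (_ + _)%E.
have [phi_pmf [[p0 _] _]] := feas.
apply: eq_bigr => -[s u] _ /=; rewrite mul_log_ratioE// => pz; split.
  move: pz; rewrite (invariant_factor s u feas) => pz.
  rewrite lt_neqAle (phi_pmf s).1 andbT.
  by apply: contraTneq pz => <-; rewrite mulr0 ltxx.
exact: ac.
Qed.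

(* (pi^lam, phi^lam) solves the IPD-Q problem with reference value r^lam: this
   is why the IPD-Q solution for r is phi^lam for any lam with r^lam = r. *)
Lemma opt_policy_minimizes (kappa : R) (p : S * U -> R) :
  0 < kappa -> invariant_pmf (trans T phi1) p ->
  let r := ref_value kappa Y lam p in
  ipdq_feasible T p phi1 /\
  forall q phi, ipdq_feasible T q phi ->
    (ipdq_cost phi0 Y kappa r p phi1 <= ipdq_cost phi0 Y kappa r q phi)%E.
Proof.
move=> kappa_gt0 p_inv r.
have feas1 : ipdq_feasible T p phi1 by split=> // s; exact: opt_policy_pmf.
split=> // q phi feas.
have [phi_pmf [[q0 q1] _]] := feas.
have [ac|/existsNP[s /existsNP[u /not_implyP[q_su /negP]]]] :=
    pselect (forall s u, 0 < q (s, u) -> 0 < phi0 s u); last first.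
  rewrite -leNgt => phi0_le0.
  have phi00 : phi0 s u = 0 by apply: le_anti; rewrite phi0_le0 (phi0_pmf s).1.
  have pos z : 0 < q z -> 0 < phi z.1 z.2.
    case: z => s' u'; rewrite (invariant_factor s' u' feas) => qz /=.
    rewrite lt_neqAle (phi_pmf s').1 andbT.
    by apply: contraTneq qz => <-; rewrite mulr0 ltxx.
  rewrite [leRHS](_ : _ = +oo%E) ?leey// /ipdq_cost pair_bigA/=.
  rewrite [X in (X + _)%E](_ : _ = +oo%E) ?addye//.
  apply/esum_eqyP => [z _|]; last first.
    exists (s, u); split; [exact: mem_index_enum|by []|rewrite /=].
    by rewrite phi00 log_ratio_pinfty ?gt0_muley//; exact: (pos (s, u)).
  have := q0 z; case: z => s' u' /=; rewrite le_eqVlt => /predU1P[<-|qz].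
    by rewrite mul0e.
  have := (phi0_pmf s').1 u'; rewrite le_eqVlt => /predU1P[<-|pz].
    by rewrite log_ratio_pinfty ?gt0_muley//; exact: (pos (s', u')).
  by rewrite log_ratioE//; exact: (pos (s', u')).
have ac1 s u : 0 < p (s, u) -> 0 < phi0 s u.
  rewrite (invariant_factor s u feas1) => pz.
  rewrite lt_neqAle (phi0_pmf s).1 andbT.
  by apply: contraTneq pz => e; rewrite /phi1 /opt_policy -e mul0r mulr0 ltxx.
rewrite !ipdq_costE// lee_fin.
have kl1 : \sum_z p z * ln (phi1 z.1 z.2 / phi0 z.1 z.2) = lam * mean p Y - xi.
  transitivity (\sum_z (p z * hbar T h z + lam * (p z * Y z)
                        - p z * h z.1 - p z * xi)).
    apply: eq_bigr => -[s u] _ /=.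
    have := p_inv.1.1 (s, u); rewrite le_eqVlt => /predU1P[<-|pz].
      by rewrite !mul0r mulr0 !subr0 addr0.
    rewrite /phi1 /opt_policy mulrAC divff ?gt_eqF ?ac1// mul1r expRK.
    by rewrite -(optimality_equationE phi0_pmf s opt_eq); ring.
  rewrite !sumrB big_split/= (invariant_mean_h feas1) -mulr_sumr -mulr_suml.
  by rewrite p_inv.1.2 /mean; ring.
have kl2 : lam * mean q Y - xi <= \sum_z q z * ln (phi z.1 z.2 / phi0 z.1 z.2).
  have bnd s : \sum_u q (s, u) * (hbar T h (s, u) + lam * Y (s, u)
      - ln (phi s u / phi0 s u)) <= (\sum_u q (s, u)) * (xi + h s).
    have qs0 : 0 <= \sum_u q (s, u) by exact: sumr_ge0.
    move: qs0; rewrite le_eqVlt => /predU1P[qs0|qs].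
      under eq_bigr do rewrite (invariant_factor s _ feas) -qs0 !mul0r.
      by rewrite -qs0 mul0r big1.
    under eq_bigr do rewrite (invariant_factor s _ feas) -mulrA.
    rewrite -mulr_sumr ler_pM2l// -lee_fin.
    have acs u : 0 < phi s u -> 0 < phi0 s u.
      by move=> pz; apply: ac; rewrite (invariant_factor s u feas) mulr_gt0.
    rewrite -one_step_valueE//.
    by have [_ ub] := opt_eq s; apply: ub; exists (phi s) => //; exact: phi_pmf.
  have : \sum_s \sum_u q (s, u) * (hbar T h (s, u) + lam * Y (s, u)
      - ln (phi s u / phi0 s u)) <= \sum_s (\sum_u q (s, u)) * (xi + h s).
    exact: ler_sum.
  under [leRHS]eq_bigr do rewrite mulr_suml.
  rewrite !pair_bigA/= -subr_ge0 -sumrB => le0.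
  rewrite -subr_ge0; apply: le_trans le0 _; rewrite le_eqVlt; apply/orP; left.
  apply/eqP.
  transitivity (\sum_z (q z * xi + q z * h z.1 - q z * hbar T h z
     - lam * (q z * Y z) + q z * ln (phi z.1 z.2 / phi0 z.1 z.2))).
    by apply: eq_bigr => -[s u] _ /=; ring.
  rewrite big_split/= !sumrB big_split/= (invariant_mean_h feas) -mulr_sumr.
  by rewrite -mulr_suml q1 /mean; ring.
rewrite kl1; apply: le_trans (lerD kl2 (lexx _)).
have -> : mean p Y = r - lam / kappa by rewrite /r /ref_value addrK.
rewrite -subr_ge0 [X in 0 <= X](_ : _ =
  kappa / 2 * (mean q Y - r + lam / kappa) ^+ 2); last by field; lra.
by rewrite mulr_ge0 ?sqr_ge0// divr_ge0// ltW.
Qed.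

End ipdq.

(* Main.v *)
Require Import Defs.
From mathcomp Require Import all_boot all_order all_algebra.
From mathcomp Require Import all_classical all_reals all_analysis.
From mathcomp Require Import ring lra.

Import Order.TTheory GRing.Theory Num.Theory.
Import numFieldNormedType.Exports.

Local Open Scope classical_set_scope.
Local Open Scope ring_scope.

(** The dynamics are bilinear in the pair of a distribution and a policy, so that
    expanding around [(pi0, phi0)] is exact: apart from [eps], the only error is
    the second order Taylor remainder, in [r], of the policy [phi_star r],
    weighted by the marginal [nu_hat0]. The content is thus the expansion
    [phi_star r = phi0 * (1 + r * Lambda_n) + O(r ^ 2)], for relative values
    [h] that are only once differentiable in the multiplier.

    Write [F t = hbar + t * Y] for the exponent of the optimal policy. Linearized
    at [t = 0], the optimality equation says that [F t - P0 (F t) = t * Y - xi t]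
    up to [O(t ^ 2)]. Averaging under [pi0] gives [xi t = O(t ^ 2)];
    differentiating gives the Poisson equation [dF - P0 dF = Y]; so
    [F t - t * dF] has a residual [O(t ^ 2)] in the Poisson equation. As the
    invariant pmf is unique, the fundamental matrix of the chain exists, and
    turns this into [F t - t * dF = c t + O(t ^ 2)] for a scalar [c t]
    ([score_expansion]). Normalizing the policy cancels [c t], and leaves
    [phi^t = phi0 * (1 + t * Lambda) + O(t ^ 2)] ([policy_expansion]).

    It remains to expand the multiplier [lam r]. The fundamental matrix also
    gives [pi^t = pi0 + O(t)], and the Poisson equation then gives
    [mean (pi^t) Y = a * t + O(t ^ 2)] ([mean_expansion]). By convex duality this
    mean is a subgradient of [xi] ([dual_value_subgradient]), hence its
    derivative, so [a] is the second derivative of [xi] at 0. Monotonicity of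
    the mean bounds [lam r] by [kappa * r] ([multiplier_le]), and inverting
    [r = (a + 1 / kappa) * lam r + O(r ^ 2)] concludes. *)

(** * Functions of a given order at 0 *)

(** The bound [f t = O(t ^ k)] as [t] tends to 0, kept as a plain predicate:
    the remainders below are multiplied, composed and summed over finite types
    while their constants change at each step. *)
Definition order0 {R : realType} (k : nat) (f : R -> R) : Prop :=
  exists C : R, \forall t \near (0 : R), `|f t| <= C * `|t| ^+ k.

Section order0_theory.
Context {R : realType}.
Implicit Types (f g : R -> R) (k l : nat).

Lemma order0_ext k f g : f =1 g -> order0 k f -> order0 k g.
Proof. by move=> /funext ->. Qed.

Lemma order0_pos k f : order0 k f ->
  exists2 C, 0 < C & \forall t \near (0 : R), `|f t| <= C * `|t| ^+ k.
Proof.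
move=> [C Cf]; exists (`|C| + 1); first by rewrite ltr_wpDl.
near=> t; apply: (@le_trans _ _ (C * `|t| ^+ k)); first by near: t; exact: Cf.
by rewrite ler_wpM2r ?exprn_ge0// (le_trans (ler_norm _))// lerDl.
Unshelve. all: by end_near. Qed.

Lemma order0_dom k f g (K : R) :
  (forall t, `|f t| <= K * `|g t|) -> order0 k g -> order0 k f.
Proof.
move=> fg [C Cg]; exists (`|K| * C); near=> t.
rewrite (le_trans (fg t))// -mulrA.
apply: (@le_trans _ _ (`|K| * `|g t|)); first by rewrite ler_wpM2r// ler_norm.
by apply: ler_wpM2l => //; near: t; exact: Cg.
Unshelve. all: by end_near. Qed.

Lemma order0_exp k : order0 k (fun t : R => t ^+ k).
Proof. by exists 1; near=> t; rewrite mul1r normrX.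
Unshelve. all: by end_near. Qed.

Lemma order0_id : order0 1 (@id R).
Proof. exact: order0_exp. Qed.

Lemma order0_cst (c : R) : order0 0 (fun=> c).
Proof. by exists `|c|; near=> t; rewrite expr0 mulr1.
Unshelve. all: by end_near. Qed.

Lemma order0_le k l f : (l <= k)%N -> order0 k f -> order0 l f.
Proof.
move=> lk /order0_pos[C C0 Cf]; exists C; near=> t.
apply: (@le_trans _ _ (C * `|t| ^+ k)); first by near: t; exact: Cf.
rewrite ler_pM2l//; apply: ler_wiXn2l lk; first exact: normr_ge0.
by near: t; exact: (@nbhs0_le R R _ ltr01).
Unshelve. all: by end_near. Qed.

Lemma order0D k f g : order0 k f -> order0 k g ->
  order0 k (fun t => f t + g t).
Proof.
move=> [C Cf] [D Dg]; exists (C + D); near=> t.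
rewrite mulrDl (le_trans (ler_normD _ _))// lerD//; near: t.
  exact: Cf.
exact: Dg.
Unshelve. all: by end_near. Qed.

Lemma order0M k l f g : order0 k f -> order0 l g ->
  order0 (k + l) (fun t => f t * g t).
Proof.
move=> [C Cf] [D Dg]; exists (C * D); near=> t.
by rewrite normrM exprD mulrACA ler_pM//; near: t; [exact: Cf|exact: Dg].
Unshelve. all: by end_near. Qed.

Lemma order0Ml k (c : R) f : order0 k f -> order0 k (fun t => c * f t).
Proof. exact: order0M (order0_cst c). Qed.

Lemma order0N k f : order0 k f -> order0 k (fun t => - f t).
Proof. by case=> C Cf; exists C; apply: filterS Cf => t; rewrite normrN. Qed.

Lemma order0B k f g : order0 k f -> order0 k g ->
  order0 k (fun t => f t - g t).
Proof. by move=> fk gk; apply: order0D => //; exact: order0N. Qed.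

Lemma order0_sum k (I : finType) (f : I -> R -> R) :
  (forall i, order0 k (f i)) -> order0 k (fun t => \sum_i f i t).
Proof.
move=> fk; elim: (index_enum I) => [|i s IHs].
  apply: (@order0_ext k (fun=> 0)) => [t|]; first by rewrite big_nil.
  by exists 0; near=> t; rewrite normr0 mul0r.
apply: (@order0_ext k (fun t => f i t + \sum_(j <- s) f j t)) => [t|].
  by rewrite big_cons.
exact: order0D.
Unshelve. all: by end_near. Qed.

Lemma order0_comp k f g : order0 k g -> order0 1 f ->
  order0 k (fun t => g (f t)).
Proof.
move=> /order0_pos[C C0 Cg] /order0_pos[D D0 Df].
have f0 : f t @[t --> (0 : R)] --> (0 : R).
  apply/cvgr0Pnorm_lt => e e0; near=> t.
  apply: (@le_lt_trans _ _ (D * `|t| ^+ 1)); first by near: t; exact: Df.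
  rewrite expr1 -ltr_pdivlMl; last exact: D0.
  near: t; apply: (@nbhs0_lt R R); by rewrite mulr_gt0 ?invr_gt0.
exists (C * D ^+ k); near=> t.
apply: (@le_trans _ _ (C * `|f t| ^+ k)).
  by near: t; exact: (f0 _ Cg).
have Dt : `|f t| <= D * `|t|.
  by near: t; apply: filterS Df => t; rewrite expr1.
by rewrite -mulrA ler_pM2l// -exprMn lerXn2r// nnegrE ?mulr_ge0 ?(ltW D0).
Unshelve. all: by end_near. Qed.

Lemma order0_at0 k f : (0 < k)%N -> order0 k f -> f 0 = 0.
Proof.
move=> k0 [C /nbhs_singleton]; rewrite normr0 expr0n gtn_eqF// mulr0.
by rewrite normr_le0 => /eqP.
Qed.

Lemma derivable_order0 f : f 0 = 0 -> derivable f (0 : R) 1 -> order0 1 f.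
Proof.
move=> f00 df; have /eqaddoP /(_ _ ltr01) Hf := derivable_nbhs df.
exists (`|'D_1 f 0| + 1); apply: filterS Hf => t.
rewrite !fctE /= addr0 f00 add0r /GRing.scale/= mulr1 mul1r expr1 => Hf.
rewrite mulrDl mul1r -lerBlDl -normrM.
by rewrite (le_trans _ Hf)// (mulrC ('D_1 f 0)) lerB_dist.
Qed.

Lemma is_derive_order0 f a : order0 2 (fun t => f t - a * t) ->
  is_derive (0 : R) 1 f a.
Proof.
move=> f2; have := order0_at0 _ _ (ltn0Sn 1) f2; rewrite mulr0 subr0 => f00.
have {f2}[C C0 Cf] := order0_pos _ _ f2.
suff D : (h^-1 *: ((f \o shift 0) (h *: (1 : R)) - f 0) @[h --> 0^'] --> a).
  by split; [apply/cvg_ex; exists a|exact: cvg_lim].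
apply/cvgrPdist_lt => e e0; near=> t.
have t0 : t != 0 by near: t; exact: nbhs_dnbhs_neq.
rewrite /= addr0 f00 subr0 /GRing.scale/= mulr1.
rewrite -[a](mulKf t0) -mulrBr normrM normfV distrC (mulrC t a).
rewrite ltr_pdivrMl ?normr_gt0//.
apply: (@le_lt_trans _ _ (C * `|t| ^+ 2)).
  by near: t; apply: nbhs_dnbhs; exact: Cf.
rewrite expr2 mulrA mulrC ltr_pM2l ?normr_gt0// -ltr_pdivlMl; last exact: C0.
near: t; apply/nbhs_dnbhs/(@nbhs0_lt R R); by rewrite mulr_gt0 ?invr_gt0.
Unshelve. all: by end_near. Qed.

(** Both second order bounds come from [1 + y <= expR y] alone: applied to [y]
    and [- y] it frames [expR], applied to logarithms it frames [ln]. *)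
Lemma order0_expR : order0 2 (fun y : R => expR y - (1 + y)).
Proof.
exists 2; near=> y.
have /ltr_normlP[y1 y2] : `|y| < 2^-1.
  by near: y; apply: (@nbhs0_lt R R); rewrite invr_gt0.
have lo := expR_ge1Dx y; have hi := expR_ge1Dx (- y).
rewrite ger0_norm ?subr_ge0// real_normK ?num_real//.
have p : 0 < 1 - y by lra.
have H : expR y * (1 - y) <= 1.
  by rewrite -[leRHS](expRxMexpNx_1 y) ler_pM2l ?expR_gt0.
rewrite lerBlDr -(ler_pM2r p) (le_trans H)//.
have : 0 <= y ^+ 2 * (1 - 2 * y) by rewrite mulr_ge0 ?sqr_ge0//; lra.
by rewrite expr2; lra.
Unshelve. all: by end_near. Qed.

Lemma order0_ln : order0 2 (fun y : R => ln (1 + y) - y).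
Proof.
exists 2; near=> y.
have /ltr_normlP[y1 y2] : `|y| < 2^-1.
  by near: y; apply: (@nbhs0_lt R R); rewrite invr_gt0.
have p : 0 < 1 + y by lra.
have hi := expR_ge1Dx (ln (1 + y)); have lo := expR_ge1Dx (- ln (1 + y)).
move: hi lo; rewrite expRN lnK ?posrE// => hi lo.
rewrite ler0_norm; last by lra.
rewrite real_normK ?num_real// opprB.
apply: (@le_trans _ _ (y - 1 + (1 + y)^-1)); first lra.
rewrite -lerBrDl -[leLHS]div1r ler_pdivrMr//.
have : 0 <= y ^+ 2 * (1 + 2 * y) by rewrite mulr_ge0 ?sqr_ge0//; lra.
by rewrite expr2; lra.
Unshelve. all: by end_near. Qed.

Lemma order0_col k n (f : 'I_n -> R -> R) : (forall i, order0 k (f i)) ->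
  (fun t => \col_i f i t) =O_ (0 : R) (fun t : R => t ^+ k).
Proof.
move=> fk; have [C C0 Cf] : exists2 C, 0 < C &
    \forall t \near (0 : R), `|\sum_i `|f i t| | <= C * `|t| ^+ k.
  apply/order0_pos/order0_sum => i; apply: order0_dom (fk i).
  by move=> t; rewrite normr_id -[leLHS]mul1r.
apply/eqO_exP; exists C => //; apply: filterS Cf => t Ct.
rewrite normrX; apply: le_trans Ct.
rewrite [leLHS]/Num.norm/=.
have [->|/mx_norm_neq0[i ->]] := eqVneq (mx_norm (\col_i f i t)) 0 => //.
by rewrite mxE [leRHS]ger0_norm ?sumr_ge0// (bigD1 i.1)//= lerDl sumr_ge0.
Qed.

End order0_theory.

(** * Finite Markov chains with a unique invariant pmf *)

Section markov_chain.
Context {R : realType} {E : finType} (P : E -> E -> R) (p : E -> R).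
Hypothesis P_pmf : forall x, is_pmf (P x).
Hypothesis p_inv : invariant_pmf P p.
Hypothesis p_uniq : forall q, invariant_pmf P q -> q = p.

Lemma sum_push (w : E -> R) : \sum_y \sum_x w x * P x y = \sum_x w x.
Proof.
rewrite exchange_big/=; apply: eq_bigr => x _.
by rewrite -mulr_sumr (P_pmf x).2 mulr1.
Qed.

Lemma invariant_normalized (v : E -> R) N : 0 < N -> (forall x, 0 <= v x) ->
  \sum_x v x = N -> (forall y, \sum_x v x * P x y = v y) ->
  forall x, v x = N * p x.
Proof.
move=> N0 v0 vN vP x; rewrite -(p_uniq (fun x => N^-1 * v x)).
  by rewrite mulVKf ?gt_eqF.
split=> [|y]; last by under eq_bigr do rewrite -mulrA; rewrite -mulr_sumr vP.
split=> [y|]; first by rewrite mulr_ge0// invr_ge0 ltW.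
by rewrite -mulr_sumr vN mulVf ?gt_eqF.
Qed.

(** Uniqueness of the invariant pmf extends to signed measures: if [w] is
    invariant, then so is [`|w|], because pushing forward preserves the total
    mass and [`|w|] is dominated by its push-forward; hence both [`|w|] and
    [`|w| + w] are multiples of [p]. *)
Lemma invariant_signed_eq0 (w : E -> R) : \sum_x w x = 0 ->
  (forall y, \sum_x w x * P x y = w y) -> forall x, w x = 0.
Proof.
move=> w0 wP; pose N : R := \sum_x `|w x|.
have absP y : \sum_x `|w x| * P x y = `|w y|.
  have dom z : 0 <= \sum_x `|w x| * P x z - `|w z|.
    rewrite subr_ge0 -{1}wP (le_trans (ler_norm_sum _ _ _))//.
    by apply: ler_sum => x _; rewrite normrM (ger0_norm ((P_pmf x).1 z)).
  have sum0 : \sum_z (\sum_x `|w x| * P x z - `|w z|) = 0.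
    by rewrite sumrB (sum_push (fun x => `|w x|)) subrr.
  apply/eqP; rewrite -subr_eq0; apply/eqP.
  exact: (psumr_eq0P _ sum0).
have : 0 <= N by exact: sumr_ge0.
rewrite le_eqVlt => /predU1P[N0 x|N0 x].
  by apply/normr0_eq0/(psumr_eq0P _ (esym N0)).
have abs_p := invariant_normalized (fun x => `|w x|) N N0
  (fun=> normr_ge0 _) erefl absP x.
have pos_p : `|w x| + w x = N * p x.
  apply: (invariant_normalized (fun x => `|w x| + w x)) => // [z||z].
  - by rewrite -lerBlDr sub0r -normrN ler_norm.
  - by rewrite big_split/= w0 addr0.
  - by under eq_bigr do rewrite mulrDl; rewrite big_split/= absP wP.
lra.
Qed.

(** [Z] is the inverse of the matrix [1 - P + 1 p], whose last term has all rows
    equal to [p]. A row vector in its kernel has mass 0, is therefore invariant,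
    and so vanishes. The last term kills functions of mean 0 and measures of mass
    0, on which [Z] thus inverts [1 - P]: bounds on the residual in a Poisson
    equation, or in an invariance equation, become bounds on the solution. *)
Lemma fundamental_matrix : exists Z : E -> E -> R,
  (forall g, mean p g = 0 ->
     forall x, g x = \sum_y Z x y * (g y - \sum_z P y z * g z)) /\
  (forall w, \sum_x w x = 0 ->
     forall y, w y = \sum_x (w x - \sum_z w z * P z x) * Z x y).
Proof.
pose v (i : 'I_#|E|) := enum_val i.
pose M := \matrix_(i < #|E|, j < #|E|)
  ((i == j)%:R - P (v i) (v j) + p (v j)).
have sumE (F : E -> R) : \sum_i F (v i) = \sum_x F x.
  by rewrite [RHS](reindex v) //; exact/onW_bij/enum_val_bij.
have sum1 (F : 'I_#|E| -> R) i : \sum_j F j * (j == i)%:R = F i.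
  rewrite (bigD1 i)//= eqxx mulr1 big1 ?addr0// => j /negPf ->.
  by rewrite mulr0.
have rowM (w : E -> R) : (\row_j w (v j)) *m M =
    \row_j (w (v j) - \sum_z w z * P z (v j) + (\sum_z w z) * p (v j)).
  apply/rowP => j; rewrite !mxE; under eq_bigr do rewrite !mxE mulrDr mulrBr.
  rewrite big_split sumrB/= (sum1 (fun i => w (v i))) -mulr_suml.
  by rewrite (sumE w) (sumE (fun z => w z * P z (v j))).
have colM (g : E -> R) : M *m (\col_i g (v i)) =
    \col_i (g (v i) - \sum_z P (v i) z * g z + mean p g).
  apply/colP => i; rewrite !mxE; under eq_bigr do rewrite !mxE mulrDl mulrBl.
  rewrite big_split sumrB/=.
  under eq_bigr do rewrite mulrC eq_sym.
  rewrite (sum1 (fun i => g (v i))) (sumE (fun z => P (v i) z * g z)).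
  by rewrite (sumE (fun z => p z * g z)).
have M_unit : M \in unitmx.
  rewrite -row_free_unit; apply/inj_row_free => u uM.
  pose w x := u 0 (enum_rank x).
  have uE : u = \row_j w (v j).
    by apply/rowP => j; rewrite mxE /w /v enum_valK.
  have wM y : w y - \sum_z w z * P z y + (\sum_z w z) * p y = 0.
    have := congr1 (fun A : 'rV_#|E| => A 0 (enum_rank y)) uM.
    by rewrite uE rowM !mxE /v enum_rankK.
  have w0 : \sum_z w z = 0.
    have : \sum_y (w y - \sum_z w z * P z y + (\sum_z w z) * p y) = 0.
      by rewrite big1.
    by rewrite big_split sumrB/= sum_push subrr add0r -mulr_sumr p_inv.1.2 mulr1.
  rewrite uE; apply/rowP => j; rewrite !mxE; apply: invariant_signed_eq0 => // y.
  by have /eqP := wM y; rewrite w0 mul0r addr0 subr_eq0 => /eqP.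
exists (fun x y => invmx M (enum_rank x) (enum_rank y)); split=> [g g0 x|w w0 y].
  have := mulKmx M_unit (\col_i g (v i)); rewrite colM.
  move=> /(congr1 (fun A : 'cV_#|E| => A (enum_rank x) 0)); rewrite !mxE.
  rewrite /v enum_rankK => <-; rewrite -[RHS]sumE; apply: eq_bigr => i _.
  by rewrite !mxE g0 addr0 /v enum_valK.
have := mulmxK M_unit (\row_j w (v j)); rewrite rowM.
move=> /(congr1 (fun A : 'rV_#|E| => A 0 (enum_rank y))); rewrite !mxE.
rewrite /v enum_rankK => <-; rewrite -[RHS]sumE; apply: eq_bigr => i _.
by rewrite !mxE w0 mul0r addr0 /v enum_valK.
Qed.

End markov_chain.

(** * Optimal policies and the convexity of the dual value *)

Section controlled_chain.
Context {R : realType} {S U : finType} (T : S * U -> S -> R).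
Context (phi0 : S -> U -> R) (Y : S * U -> R).
Hypothesis T_pmf : forall z, is_pmf (T z).
Hypothesis phi0_pmf : forall s, is_pmf (phi0 s).

(** The exponent of the optimal policy, before normalization. *)
Definition score (lam : R) (h : S -> R) (x : S * U) : R :=
  hbar T h x + lam * Y x.

Lemma sum_pair (F : S * U -> R) : \sum_x F x = \sum_s \sum_u F (s, u).
Proof. by rewrite pair_bigA; apply: eq_bigr => -[]. Qed.

Lemma sum_trans (phi : S -> U -> R) z (f : S * U -> R) :
  \sum_x trans T phi z x * f x = \sum_s T z s * policy_mean phi f s.
Proof.
rewrite sum_pair; apply: eq_bigr => s _.
by rewrite mulr_sumr; apply: eq_bigr => u _; rewrite mulrA.
Qed.

Lemma policy_mean_cst (phi : S -> U -> R) s (c : R) :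
  is_pmf (phi s) -> policy_mean phi (fun=> c) s = c.
Proof. by move=> [_ phi1]; rewrite /policy_mean -mulr_suml phi1 mul1r. Qed.

Lemma trans_pmf (phi : S -> U -> R) :
  (forall s, is_pmf (phi s)) -> forall z, is_pmf (trans T phi z).
Proof.
move=> phi_pmf z; split=> [x|].
  by rewrite mulr_ge0 ?(T_pmf z).1 ?(phi_pmf _).1.
under eq_bigr do rewrite -[trans _ _ _ _]mulr1.
rewrite (sum_trans phi z (fun=> 1)).
under eq_bigr => s _ do rewrite policy_mean_cst// mulr1.
exact: (T_pmf z).2.
Qed.

(** The mean of [Y] under the invariant pmf is a subgradient of the dual value.
    With [d] the difference of the two log-policies, [1 + d <= expR d] turns the
    [p]-mean of [d] into a difference of two total masses, which vanishes; in
    that mean the relative values cancel by invariance of [p]. *)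
Lemma dual_value_subgradient (a b xa xb : R) (ha hb : S -> R)
    (p : S * U -> R) :
  optimality_equation T phi0 Y a xa ha -> optimality_equation T phi0 Y b xb hb ->
  invariant_pmf (trans T (opt_policy T phi0 Y a ha)) p ->
  xa + (b - a) * mean p Y <= xb.
Proof.
move=> opt_a opt_b p_inv.
set phia := opt_policy T phi0 Y a ha in p_inv *.
pose phib := opt_policy T phi0 Y b hb.
pose d (z : S * U) := (score b hb z - Gamma T phi0 Y b hb z.1)
  - (score a ha z - Gamma T phi0 Y a ha z.1).
have phia_pmf s : is_pmf (phia s) by exact: opt_policy_pmf.
have phib_pmf s : is_pmf (phib s) by exact: opt_policy_pmf.
have feas : ipdq_feasible T p phia by [].
have phibE s u : phib s u = phia s u * expR (d (s, u)).
  rewrite /phib /phia /opt_policy -mulrA -expRD; congr (_ * expR _).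
  by rewrite /d /score/=; ring.
have d_le0 : \sum_z p z * d z <= 0.
  have le1 (z : S * U) : p z * d z <= \sum_v p (z.1, v) *
      (phib z.1 z.2 - phia z.1 z.2).
    case: z => s u /=; rewrite -mulr_suml (invariant_factor s u feas) -mulrA.
    have nu0 : 0 <= \sum_v p (s, v) by apply: sumr_ge0 => v _; exact: p_inv.1.1.
    apply: ler_wpM2l => //; rewrite phibE -[X in _ - X]mulr1 -mulrBr.
    apply: ler_wpM2l; first exact: (phia_pmf s).1.
    by rewrite lerBrDl expR_ge1Dx.
  apply: (le_trans (ler_sum _ (fun z _ => le1 z))).
  rewrite sum_pair big1//= => s _; under eq_bigr do rewrite -mulr_suml.
  by rewrite -mulr_sumr sumrB (phia_pmf s).2 (phib_pmf s).2 subrr mulr0.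
have dE : \sum_z p z * d z = (b - a) * mean p Y - (xb - xa).
  transitivity (\sum_z ((p z * hbar T hb z - p z * hb z.1)
     - (p z * hbar T ha z - p z * ha z.1)
     + ((b - a) * (p z * Y z) - p z * (xb - xa)))).
    apply: eq_bigr => z _; rewrite /d.
    rewrite -(optimality_equationE phi0_pmf z.1 opt_a).
    by rewrite -(optimality_equationE phi0_pmf z.1 opt_b) /score; ring.
  rewrite big_split/= !sumrB (invariant_mean_h hb feas) (invariant_mean_h ha feas).
  by rewrite !subrr add0r -mulr_sumr -mulr_suml p_inv.1.2 mul1r.
by move: d_le0; rewrite dE; lra.
Qed.

End controlled_chain.

(** * Expansion of the optimal policy and of its invariant pmf *)

Lemma is_derive_fin_sum {R : realType} {I : finType} (f : I -> R -> R)
    (df : I -> R) (t : R) :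
  (forall i, is_derive t 1 (f i) (df i)) ->
  is_derive t 1 (fun y => \sum_i f i y) (\sum_i df i).
Proof.
move=> fdf; elim: (index_enum I) => [|i s IHs].
  rewrite big_nil [X in is_derive _ _ X](_ : _ = cst 0).
    exact: is_derive_cst.
  by apply/funext => y; rewrite big_nil.
rewrite big_cons [X in is_derive _ _ X](_ : _ =
    f i + (fun y => \sum_(j <- s) f j y)).
  exact: is_deriveD.
by apply/funext => y; rewrite big_cons.
Qed.

Lemma is_deriveMl {R : realType} (f : R -> R) (c df t : R) :
  is_derive t 1 f df -> is_derive t 1 (fun y => c * f y) (c * df).
Proof. exact: is_deriveZ. Qed.

Lemma pmf_order0 {R : realType} {E : finType} (p : R -> E -> R) x :
  (forall t, is_pmf (p t)) -> order0 0 (fun t => p t x).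
Proof.
move=> p_pmf; exists 1; near=> t.
rewrite expr0 mulr1 ger0_norm ?(p_pmf t).1//.
rewrite -(p_pmf t).2 (bigD1 x)//= lerDl; apply: sumr_ge0 => y _.
exact: (p_pmf t).1.
Unshelve. all: by end_near. Qed.

Section expansion.
Context {R : realType} {S U : finType} (T : S * U -> S -> R).
Hypothesis T_pmf : forall z, is_pmf (T z).
Context (phi0 : S -> U -> R).
Hypothesis phi0_pmf : forall s, is_pmf (phi0 s).
Context (pi0 : S * U -> R).
Hypothesis pi0_inv : invariant_pmf (trans T phi0) pi0.
Hypothesis pi0_uniq : forall p, invariant_pmf (trans T phi0) p -> p = pi0.
Context (Y : S * U -> R) (xi : R -> R) (h : R -> S -> R).
Hypothesis opt_eq : forall t : R, optimality_equation T phi0 Y t (xi t) (h t).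
Hypothesis h_derivable : forall s (t : R), derivable (h ^~ s) t 1.
Hypothesis h0 : forall s, h 0 s = 0.
Hypothesis Y_mean0 : mean pi0 Y = 0.

Let P0 := trans T phi0.
Let F t := score T Y t (h t).
Let dF x := Hbar0 T h x + Y x.
Let G t := Gamma T phi0 Y t (h t).
Let phi t := opt_policy T phi0 Y t (h t).
Let L x := Lambda T phi0 Y h x.

Let P0_pmf : forall x, is_pmf (P0 x).
Proof. exact: trans_pmf. Qed.

Lemma hbar_derivable (t : R) x : derivable (fun y => hbar T (h y) x) t 1.
Proof.
have D s : is_derive t 1 (fun y => T x s * h y s) (T x s * 'D_1 (h ^~ s) t).
  by apply: is_deriveMl; exact: derivableP.
by have [] := is_derive_fin_sum _ _ t D.
Qed.

Lemma score_is_derive (t : R) x :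
  is_derive t 1 (F ^~ x) ('D_1 (fun y => hbar T (h y) x) t + Y x).
Proof.
rewrite [X in is_derive _ _ X](_ : _ =
    (fun y => hbar T (h y) x) + (fun y => Y x * id y)).
  apply: is_deriveD; first by apply: derivableP; exact: hbar_derivable.
  by rewrite -[X in is_derive _ _ _ X]mulr1; exact: is_deriveMl.
by apply/funext => y; rewrite /F /score fctE mulrC.
Qed.

Lemma score0_is_derive x : is_derive (0 : R) 1 (F ^~ x) (dF x).
Proof. by rewrite /dF /Hbar0 derive1E; exact: score_is_derive. Qed.

Lemma score0 x : F 0 x = 0.
Proof.
by rewrite /F /score mul0r addr0 /hbar big1// => s _; rewrite h0 mulr0.
Qed.

Lemma score_order1 x : order0 1 (F ^~ x).
Proof.
apply: derivable_order0; first exact: score0.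
by have [] := score0_is_derive x.
Qed.

Lemma policy_mean_order0 k (f : R -> S * U -> R) s :
  (forall x, order0 k (f ^~ x)) ->
  order0 k (fun t => policy_mean phi0 (f t) s).
Proof. by move=> fk; apply: order0_sum => u; exact: order0Ml. Qed.

(** The exponent is of order 1, so that [expR] and [ln] only contribute their
    linear parts. *)
Lemma Gamma_expansion s :
  order0 2 (fun t => G t s - policy_mean phi0 (F t) s).
Proof.
pose y t := policy_mean phi0 (fun x => expR (F t x) - 1) s.
have e2 x : order0 2 (fun t => expR (F t x) - (1 + F t x)).
  exact: (order0_comp _ _ _ order0_expR (score_order1 x)).
have y2 : order0 2 (fun t => y t - policy_mean phi0 (F t) s).
  apply: order0_ext (policy_mean_order0 _ _ s e2) => t.
  rewrite /y /policy_mean -sumrB; apply: eq_bigr => u _; ring.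
have y1 : order0 1 y.
  have F1 := policy_mean_order0 _ _ s score_order1.
  apply: order0_ext (order0D _ _ _ (order0_le _ _ _ (ltnW (ltnSn 1)) y2) F1) => t.
  by rewrite subrK.
apply: order0_ext (order0D _ _ _ (order0_comp _ _ _ order0_ln y1) y2) => t.
rewrite addrA subrK; congr (ln _ - _); rewrite /y /policy_mean.
under eq_bigr do rewrite mulrBr mulr1.
by rewrite sumrB (phi0_pmf s).2 addrC subrK.
Qed.

(** The optimality equation, pushed through [T] and linearized: up to second
    order the exponent solves a Poisson equation for the nominal chain. *)
Lemma score_poisson x : order0 2 (fun t =>
  F t x - \sum_z P0 x z * F t z - t * Y x + xi t).
Proof.
have GF : order0 2 (fun t =>
    \sum_s T x s * (G t s - policy_mean phi0 (F t) s)).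
  by apply: order0_sum => s; apply: order0Ml; exact: Gamma_expansion.
apply: order0_ext GF => t.
rewrite (sum_trans T phi0 x (F t)) /G.
under eq_bigr => s _ do
  rewrite -(optimality_equationE phi0_pmf s (opt_eq t)) mulrBr mulrDr.
rewrite sumrB big_split/= -mulr_suml (T_pmf x).2 mul1r.
rewrite /F {2}/score /hbar; ring.
Qed.

Lemma mean_pi0_P0 (f : S * U -> R) :
  \sum_x pi0 x * (\sum_z P0 x z * f z) = mean pi0 f.
Proof.
under eq_bigr do rewrite mulr_sumr; rewrite exchange_big/=.
apply: eq_bigr => z _; rewrite -pi0_inv.2 mulr_suml.
by apply: eq_bigr => x _; rewrite mulrA.
Qed.

Lemma dual_value_order2 : order0 2 xi.
Proof.
have H : order0 2 (fun t =>
    \sum_x pi0 x * (F t x - \sum_z P0 x z * F t z - t * Y x + xi t)).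
  by apply: order0_sum => x; apply: order0Ml; exact: score_poisson.
apply: order0_ext H => t.
under eq_bigr do rewrite mulrDr !mulrBr mulrCA.
rewrite big_split !sumrB/= mean_pi0_P0 -/(mean _ _) subrr -mulr_sumr.
rewrite -/(mean pi0 Y) Y_mean0 mulr0 subr0 add0r.
by rewrite -mulr_suml pi0_inv.1.2 mul1r.
Qed.

Lemma score_residual x : order0 2 (fun t =>
  F t x - \sum_z P0 x z * F t z - Y x * t).
Proof.
apply: order0_ext (order0B _ _ _ (score_poisson x) dual_value_order2) => t.
ring.
Qed.

Lemma dscore_poisson x : dF x - \sum_z P0 x z * dF z = Y x.
Proof.
have D1 := is_derive_order0 _ _ (score_residual x).
have D2 : is_derive (0 : R) 1 (fun t => F t x - \sum_z P0 x z * F t z)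
    (dF x - \sum_z P0 x z * dF z).
  apply: is_deriveB; first exact: score0_is_derive.
  by apply: is_derive_fin_sum => z; apply: is_deriveMl; exact: score0_is_derive.
by rewrite -(@derive_val _ _ _ _ _ _ _ D1) -(@derive_val _ _ _ _ _ _ _ D2).
Qed.

(** Differentiability alone gives [F t = t * dF + o(t)]. The Poisson equation
    improves the remainder to second order, up to a function of [t] alone, which
    the normalization of the policy removes. *)
Lemma score_expansion : exists c : R -> R, forall x,
  order0 2 (fun t => F t x - t * dF x - c t).
Proof.
have [Z [Zfun _]] := fundamental_matrix _ _ P0_pmf pi0_inv pi0_uniq.
pose D t x := F t x - t * dF x.
exists (fun t => mean pi0 (D t)) => x.
have H : order0 2 (fun t =>
    \sum_y Z x y * (F t y - \sum_z P0 y z * F t z - Y y * t)).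
  by apply: order0_sum => y; apply: order0Ml; exact: score_residual.
apply: order0_ext H => t; rewrite -/(D t x).
rewrite [RHS](Zfun (fun x => D t x - mean pi0 (D t))); last first.
  rewrite /mean; under eq_bigr do rewrite mulrBr.
  by rewrite sumrB -mulr_suml pi0_inv.1.2 mul1r subrr.
apply: eq_bigr => y _; congr (_ * _); rewrite -[Y y]dscore_poisson /D.
under [in RHS]eq_bigr do rewrite 2!mulrBr [P0 y _ * (t * _)]mulrCA.
rewrite !sumrB/= -mulr_sumr -mulr_suml (P0_pmf y).2; ring.
Qed.

Lemma policy_meanB (f g : S * U -> R) s :
  policy_mean phi0 (fun x => f x - g x) s =
  policy_mean phi0 f s - policy_mean phi0 g s.
Proof. by rewrite -sumrB; apply: eq_bigr => u _; rewrite mulrBr. Qed.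

(** Subtracting the expansion of [Gamma] centers [dF] under [phi0], which yields
    [Lambda], and cancels the scalar of [score_expansion]. *)
Lemma log_policy_expansion x : order0 2 (fun t => F t x - G t x.1 - t * L x).
Proof.
have [c Fc] := score_expansion.
have H := order0B _ _ _ (Fc x) (order0D _ _ _ (policy_mean_order0 _ _ x.1 Fc)
  (Gamma_expansion x.1)).
apply: order0_ext H => t.
rewrite !policy_meanB policy_mean_cst//.
have -> : policy_mean phi0 (fun x => t * dF x) x.1 =
    t * (policy_mean phi0 (Hbar0 T h) x.1 + policy_mean phi0 Y x.1).
  rewrite /policy_mean -big_split mulr_sumr; apply: eq_bigr => u _ /=.
  by rewrite /dF; ring.
rewrite /L /Lambda /dF; ring.
Qed.

Lemma policy_expansion s u : order0 2 (fun t =>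
  phi t s u - phi0 s u - t * (phi0 s u * L (s, u))).
Proof.
have g2 := log_policy_expansion (s, u).
have g1 : order0 1 (fun t => F t (s, u) - G t s).
  have tL := order0M _ _ _ _ order0_id (order0_cst (L (s, u))).
  have H := order0_le _ _ _ (ltnW (ltnSn 1)) g2.
  apply: order0_ext (order0D _ _ _ H tL) => t.
  by rewrite /= subrK.
have H := order0Ml _ (phi0 s u) _
  (order0D _ _ _ (order0_comp _ _ _ order0_expR g1) g2).
apply: order0_ext H => t; rewrite /phi /opt_policy /= -/(G t s) -/(F t (s, u)).
rewrite -[_ + t * Y _]/(F t (s, u)); ring.
Qed.

Lemma policy_order1 s u : order0 1 (fun t => phi t s u - phi0 s u).
Proof.
have tL := order0M _ _ _ _ order0_id (order0_cst (phi0 s u * L (s, u))).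
have H := order0_le _ _ _ (ltnW (ltnSn 1)) (policy_expansion s u).
by apply: order0_ext (order0D _ _ _ H tL) => t; rewrite /= subrK.
Qed.

Context (pi_ : R -> S * U -> R).
Hypothesis pi_inv : forall t, invariant_pmf (trans T (phi t)) (pi_ t).

(** The defect of invariance of [pi_ t] under [P0] comes from the change of
    policy alone, which is of order 1. *)
Lemma invariant_pmf_order1 y : order0 1 (fun t => pi_ t y - pi0 y).
Proof.
have [Z [_ Zmeas]] := fundamental_matrix _ _ P0_pmf pi0_inv pi0_uniq.
have H : order0 1 (fun t => \sum_x
    (\sum_z pi_ t z * (T z x.1 * (phi t x.1 x.2 - phi0 x.1 x.2))) * Z x y).
  apply: order0_sum => x; apply: (order0M 1 0); last exact: order0_cst.
  apply: order0_sum => z; apply: (order0M 0 1).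
    by apply: pmf_order0 => t; case: (pi_inv t).
  by apply: order0Ml; exact: policy_order1.
apply: order0_ext H => t.
rewrite [RHS](Zmeas (fun y => pi_ t y - pi0 y)); last first.
  by rewrite sumrB (pi_inv t).1.2 pi0_inv.1.2 subrr.
apply: eq_bigr => x _; congr (_ * _).
under [in RHS]eq_bigr do rewrite mulrBl.
rewrite sumrB -[pi_ t x](pi_inv t).2 -/P0 pi0_inv.2 opprB addrA subrK -sumrB.
by apply: eq_bigr => z _; rewrite /P0 /trans; ring.
Qed.

(** By the Poisson equation and invariance, the mean of [Y] only sees the
    change of transition matrix, which is linear in [t] up to second order. *)
Lemma mean_expansion : exists a, order0 2 (fun t => mean (pi_ t) Y - a * t).
Proof.
exists (\sum_z \sum_x pi0 z * (T z x.1 * (phi0 x.1 x.2 * L x) * dF x)).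
have H : order0 2 (fun t => \sum_z \sum_x
    (T z x.1 * dF x * (pi_ t z *
       (phi t x.1 x.2 - phi0 x.1 x.2 - t * (phi0 x.1 x.2 * L x)))
     + T z x.1 * phi0 x.1 x.2 * L x * dF x * (t * (pi_ t z - pi0 z)))).
  apply: order0_sum => z; apply: order0_sum => x.
  apply: order0D; apply: order0Ml.
    apply: (order0M 0 2).
      by apply: pmf_order0 => t; case: (pi_inv t).
    by case: x => s u; exact: policy_expansion.
  by apply: (order0M 1 1); [exact: order0_id|exact: invariant_pmf_order1].
apply: order0_ext H => t.
have -> : mean (pi_ t) Y = \sum_z \sum_x
    pi_ t z * ((trans T (phi t) z x - P0 z x) * dF x).
  transitivity (\sum_z pi_ t z * (dF z - \sum_x P0 z x * dF x)).
    by apply: eq_bigr => z _; rewrite dscore_poisson.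
  transitivity (\sum_z \sum_x pi_ t z * trans T (phi t) z x * dF x
      - \sum_z \sum_x pi_ t z * (P0 z x * dF x)).
    under eq_bigr do rewrite mulrBr mulr_sumr.
    rewrite sumrB; congr (_ - _); rewrite exchange_big/=.
    by apply: eq_bigr => x _; rewrite -mulr_suml (pi_inv t).2.
  rewrite -sumrB; apply: eq_bigr => z _; rewrite -sumrB; apply: eq_bigr => x _.
  ring.
rewrite mulr_suml -sumrB; apply: eq_bigr => z _.
rewrite mulr_suml -sumrB; apply: eq_bigr => x _.
rewrite /P0 /trans; ring.
Qed.

Lemma dual_value_derivable (t : R) : derivable xi t 1.
Proof.
have [[s u] _] := pmf_gt0 pi0_inv.1.
have -> : xi = (fun y => G y s) - h ^~ s.
  apply/funext => y; rewrite fctE.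
  by rewrite /G -(optimality_equationE phi0_pmf s (opt_eq y)) addrK.
apply: derivableB => //.
have D : is_derive t 1 (fun y => \sum_v phi0 s v * expR (F y (s, v)))
    (\sum_v phi0 s v *
      (expR (F t (s, v)) * ('D_1 (fun y => hbar T (h y) (s, v)) t + Y (s, v)))).
  apply: is_derive_fin_sum => v; apply: is_deriveMl.
  by apply: is_derive1_comp; exact: score_is_derive.
have Z_gt0 := opt_policy_sum_gt0 T Y phi0_pmf t (h t) s.
by have [] := is_derive1_comp (is_derive1_ln Z_gt0) D.
Qed.

(** A differentiable function has no other subgradient than its derivative: it
    becomes minimal at [t] once the supporting line at [t] is subtracted. *)
Lemma dual_value_derive : derive1 xi = fun t => mean (pi_ t) Y.
Proof.
apply/funext => t; set m := mean (pi_ t) Y.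
have lin (y : R) : is_derive y 1 (fun b => m * id b) m.
  by rewrite -[X in is_derive _ _ _ X]mulr1; exact: is_deriveMl.
have Dmin : is_derive t 1 (xi - (fun b => m * id b)) 0.
  apply: (@derive1_at_min _ _ (t - 1) (t + 1)).
  - by lra.
  - move=> y _; apply: derivableB; first exact: dual_value_derivable.
    by have [] := lin y.
  - by rewrite in_itv/=; apply/andP; split; lra.
  - move=> y _; rewrite !fctE.
    have := dual_value_subgradient T phi0 Y phi0_pmf _ _ _ _ _ _ _
      (opt_eq t) (opt_eq y) (pi_inv t).
    by rewrite -/m /=; lra.
have D := is_deriveD Dmin (lin t).
rewrite derive1E; move: D; rewrite subrK add0r => D.
exact: (@derive_val _ _ _ _ _ _ _ D).
Qed.

Lemma mean_derive :
  order0 2 (fun t => mean (pi_ t) Y - derive1n 2 xi 0 * t).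
Proof.
have [a Ha] := mean_expansion.
suff -> : derive1n 2 xi 0 = a by [].
rewrite /derive1n/= dual_value_derive derive1E.
exact: (@derive_val _ _ _ _ _ _ _ (is_derive_order0 _ _ Ha)).
Qed.

(** Subgradients of a function of one variable are monotone. *)
Lemma mean_ge0 t : 0 <= t * mean (pi_ t) Y.
Proof.
have m0 : mean (pi_ 0) Y = 0.
  have [a Ha] := mean_expansion.
  by have := order0_at0 _ _ (ltn0Sn 1) Ha; rewrite mulr0 subr0.
have sub a b := dual_value_subgradient T phi0 Y phi0_pmf _ _ _ _ _ _ _
  (opt_eq a) (opt_eq b) (pi_inv a).
have := sub 0 t; have := sub t 0; rewrite m0 /=; lra.
Qed.

Context (kappa : R).
Hypothesis kappa_gt0 : 0 < kappa.

(** As the mean of [Y] has the sign of the multiplier, the regularization alone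
    keeps the reference value away from 0. *)
Lemma multiplier_le t : `|t| <= kappa * `|ref_value kappa Y t (pi_ t)|.
Proof.
have [->|t0] := eqVneq t 0; first by rewrite normr0 mulr_ge0// ltW.
rewrite -ler_pdivrMl// -(ler_pM2l (_ : 0 < `|t|)) ?normr_gt0// -normrM.
apply: le_trans (ler_norm _); rewrite mulrCA -expr2 real_normK ?num_real//.
rewrite /ref_value mulrDr expr2 mulrCA [t / kappa]mulrC lerDr.
exact: mean_ge0.
Qed.

Let c := derive1n 2 xi 0 + kappa^-1.

Lemma ref_value_expansion :
  order0 2 (fun t => ref_value kappa Y t (pi_ t) - c * t).
Proof.
by apply: order0_ext mean_derive => t; rewrite /ref_value /c; ring.
Qed.

(** Otherwise the multiplier, which the reference value dominates, would be of
    order 2 in itself. *)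
Lemma ref_slope_neq0 : c != 0.
Proof.
apply/eqP => c0; have id2 : order0 2 (fun t : R => id t - 0 * t).
  apply: (order0_dom _ _ _ kappa _ ref_value_expansion) => t.
  by rewrite c0 mul0r !subr0; exact: multiplier_le.
have := @derive_val _ _ _ _ _ _ _ (is_derive_order0 _ _ id2).
by rewrite derive_id => /eqP; rewrite oner_eq0.
Qed.

Context (lam : R -> R).
Hypothesis lam_ref : forall r, ref_value kappa Y (lam r) (pi_ (lam r)) = r.

Lemma multiplier_order1 : order0 1 lam.
Proof.
apply: (order0_dom _ _ _ kappa _ order0_id) => r.
by rewrite -[X in _ * `|X|]lam_ref; exact: multiplier_le.
Qed.

Lemma multiplier_expansion : order0 2 (fun r => lam r - c^-1 * r).
Proof.
have H := order0_comp _ _ _ ref_value_expansion multiplier_order1.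
apply: order0_ext (order0Ml _ (- c^-1) _ H) => r.
by rewrite lam_ref mulrBr !mulNr mulKf ?ref_slope_neq0// opprK addrC.
Qed.

Lemma policy_star_expansion s u : order0 2 (fun r =>
  phi (lam r) s u - phi0 s u
  - r * (phi0 s u * Lambda_n T phi0 Y kappa xi h (s, u))).
Proof.
have H := order0_comp _ _ _ (policy_expansion s u) multiplier_order1.
have H' := order0Ml _ (phi0 s u * L (s, u)) _ multiplier_expansion.
apply: order0_ext (order0D _ _ _ H H') => r.
rewrite /Lambda_n -/c -/(L (s, u)); ring.
Qed.

End expansion.

(** * The closed loop *)

Theorem proposition3p5
  (R : realType) (S U : finType)
  (n : nat) (x : 'I_n -> S * U) (x_bij : bijective x)
  (T : S * U -> S -> R) (T_pmf : forall z, is_pmf (T z))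
  (phi0 : S -> U -> R) (phi0_pmf : forall s, is_pmf (phi0 s))
  (pi0 : S * U -> R)
  (pi0_inv : invariant_pmf (trans T phi0) pi0)
  (pi0_uniq : forall p, invariant_pmf (trans T phi0) p -> p = pi0)
  (Y : S * U -> R) (kappa : R) (kappa_gt0 : 0 < kappa)
  (xi : R -> R) (h : R -> S -> R)
  (opt_eq : forall lam : R,
     optimality_equation T phi0 Y lam (xi lam) (h lam))
  (h_derivable : forall (s : S) (lam : R), derivable (h ^~ s) lam 1)
  (h_C1 : forall s : S, continuous (derive1 (h ^~ s)))
  (h0 : forall s : S, h 0 s = 0)
  (pi_ : R -> S * U -> R)
  (pi_inv : forall lam : R,
     invariant_pmf (trans T (opt_policy T phi0 Y lam (h lam))) (pi_ lam))
  (lam_ : R -> R)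
  (lam_ref : forall r : R, ref_value kappa Y (lam_ r) (pi_ (lam_ r)) = r)
  (Y_mean0 : mean pi0 Y = 0) :
  let phi_star (r : R) := opt_policy T phi0 Y (lam_ r) (h (lam_ r)) in
  let nu_hat0 (s : S) := \sum_u pi0 (s, u) in
  let A : 'M[R]_n := \matrix_(i, j) trans T phi0 (x j) (x i) in
  let B : 'M[R]_n := \matrix_(i, j) ((i == j)%:R * nu_hat0 (x j).1) in
  let G_star : 'cV[R]_n :=
    \col_i (phi0 (x i).1 (x i).2 * Lambda_n T phi0 Y kappa xi h (x i)) in
  exists rem : R -> 'cV[R]_n,
    rem =O_ (0 : R) (fun r : R => r ^+ 2) /\
    forall (r : nat -> R) (phi : nat -> S -> U -> R) (nu : nat -> S * U -> R),
      (forall k s u, phi k s u = phi_star (r k) s u) ->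
      (forall k s' u',
         nu k.+1 (s', u') = \sum_z nu k z * T z s' * phi k s' u') ->
      let nu_tilde k z := nu k z - pi0 z in
      let phi_tilde k s u := phi k s u - phi0 s u in
      let X_tilde k : 'cV[R]_n := \col_i nu_tilde k (x i) in
      let eps k : 'cV[R]_n :=
        \col_i \sum_j nu_tilde k (x j) * T (x j) (x i).1
                        * phi_tilde k (x i).1 (x i).2 in
      forall k,
        X_tilde k.+1 =
          A *m X_tilde k + r k *: (B *m G_star) + eps k + rem (r k).
Proof.
move=> phi_star nu_hat0 A B G_star.
pose res (z : S * U) r := phi_star r z.1 z.2 - phi0 z.1 z.2
  - r * (phi0 z.1 z.2 * Lambda_n T phi0 Y kappa xi h z).
have res2 z : order0 2 (res z).
  case: z => s u.
  by apply: (policy_star_expansion T T_pmf phi0 phi0_pmf pi0 pi0_inv pi0_uniq Y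
    xi h opt_eq h_derivable h0 Y_mean0 pi_ pi_inv kappa kappa_gt0 lam_ lam_ref).
(* [nu_hat0] appears because [pi0] carries the variation of the policy to the
   state marginal of its successor. *)
exists (fun r => \col_i (nu_hat0 (x i).1 * res (x i) r)); split.
  by apply: order0_col => i; exact: order0Ml.
move=> r phi nu phiE nuE nu_tilde phi_tilde X_tilde eps k.
have sumE (f : S * U -> R) : \sum_j f (x j) = \sum_z f z.
  by rewrite [RHS](reindex x)//; exact: onW_bij.
have pi0_step s u : pi0 (s, u) = \sum_z pi0 z * T z s * phi0 s u.
  by rewrite -pi0_inv.2; apply: eq_bigr => z _; rewrite /trans mulrA.
have nu_hat0E s : nu_hat0 s = \sum_z pi0 z * T z s.
  by rewrite /nu_hat0 (invariant_marginal s (conj phi0_pmf pi0_inv)).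
apply/colP => i; rewrite !mxE.
have -> : \sum_j B i j * G_star j 0 = nu_hat0 (x i).1 * G_star i 0.
  rewrite (bigD1 i)//= !mxE eqxx mul1r big1 ?addr0// => j ji.
  by rewrite mxE eq_sym (negPf ji) !mul0r.
under [in RHS]eq_bigr do rewrite !mxE.
rewrite (sumE (fun z => trans T phi0 z (x i) * nu_tilde k z)).
rewrite (sumE (fun z =>
  nu_tilde k z * T z (x i).1 * phi_tilde k (x i).1 (x i).2)).
rewrite !mxE /nu_tilde /res -phiE; case: (x i) => s u /=.
rewrite nuE pi0_step /phi_tilde.
set L := Lambda_n _ _ _ _ _ _ _.
transitivity (\sum_z (trans T phi0 z (s, u) * (nu k z - pi0 z)
  + (nu k z - pi0 z) * T z s * (phi k s u - phi0 s u)
  + (pi0 z * T z s) * (phi k s u - phi0 s u))).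
  by rewrite -sumrB; apply: eq_bigr => z _; rewrite /trans/=; ring.
rewrite !big_split/= -[X in _ + X = _]mulr_suml -nu_hat0E; ring.
Qed.
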